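(* Let $d>0$ be an integer and let $f:\{1,\dots,d\}\to \mathbb{R}_{>0}$. Assume that for every $j\le d$, \[ \sum_{i=1}^{j-1}\left(\frac{2\pi e}{j-i}\right)^{\frac{j-i}{2}}\left(1-\left(\frac{f(j)}{f(i)}\right)^2\right)_+^{\frac{j-i}{2}}\left(\prod_{k=i}^{j}\frac{f(i)}{f(k)}\right)<1 . \] Then there exists an HKZ-reduced lattice basis $(\vec b_1,\dots,\vec b_d)$ whose Gram–Schmidt vectors satisfy $\|\vec b_i^*\|=f(i)$ for all $i\le d$.
   Context: For real $x$, $(x)_+=\max(x,0)$; $e$ is Euler's number. For linearly independent $\vec b_1,\dots,\vec b_d\in\mathbb{R}^n$, the Gram–Schmidt orthogonalisation is $\vec b_i^*=\vec b_i-\sum_{j<i}\mu_{i,j}\vec b_j^*$ with $\mu_{i,j}=\langle \vec b_i,\vec b_j^*\rangle/\|\vec b_j^*\|^2$; $\vec b_i(j)$ (for $j\le i$) denotes the projection of $\vec b_i$ orthogonally to $\vec b_1,\dots,\vec b_{j-1}$. A basis $(\vec b_1,\dots,\vec b_d)$ of a lattice $L$ is HKZ-reduced (Hermite–Korkine–Zolotarev) if $\vec b_1$ is a shortest nonzero vector of $L$ and, recursively, $(\vec b_2(2),\dots,\vec b_d(2))$ is an HKZ-reduced basis of the projected lattice (a one-vector basis is always HKZ-reduced). *)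

(* Defs.v *)
From HB Require Import structures.
From mathcomp Require Import all_boot all_order all_algebra.
From mathcomp Require Import reals.

Set Implicit Arguments.
Unset Strict Implicit.
Unset Printing Implicit Defensive.

Import Order.TTheory GRing.Theory Num.Theory.
Local Open Scope ring_scope.

(* A family (b_1, ..., b_d) of vectors of R^n is the matrix B : 'M_(d, n) whose
   rows are the b_i; indices are shifted to start from 0. *)

Definition dotp (R : realType) (n : nat) (u v : 'rV[R]_n) : R :=
  \sum_(k < n) u 0 k * v 0 k.

(* The Euclidean norm; the library norm on matrices is the sup norm. *)
Definition enorm (R : realType) (n : nat) (u : 'rV[R]_n) : R :=
  Num.sqrt (dotp u u).

Definition proj_coef (R : realType) (n : nat) (v u : 'rV[R]_n) : R :=
  dotp v u / dotp u u.

(* The list acc holds b_1^*, ..., b_{i-1}^*; this appends b_i^*. *)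
Definition gs_step (R : realType) (n : nat) (acc : seq 'rV[R]_n)
    (b : 'rV[R]_n) : seq 'rV[R]_n :=
  rcons acc (b - \sum_(v <- acc) proj_coef b v *: v).

Definition gram_schmidt (R : realType) (d n : nat) (B : 'M[R]_(d, n)) :
    'M[R]_(d, n) :=
  \matrix_(i < d) nth 0 (foldl (@gs_step R n) [::] [seq row k B | k : 'I_d]) i.

(* The defining recurrence, with proj_coef (row i B) (row j (gram_schmidt B))
   the coefficient mu_{i,j}. *)
Lemma gram_schmidtE (R : realType) (d n : nat) (B : 'M[R]_(d, n)) (i : 'I_d) :
  row i (gram_schmidt B) =
    row i B - \sum_(j < d | (j < i)%N)
      proj_coef (row i B) (row j (gram_schmidt B)) *: row j (gram_schmidt B).
Proof.
pose s := [seq row k B | k : 'I_d].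
pose g m := foldl (@gs_step R n) [::] (take m s).
have szs : size s = d by rewrite size_map -cardE card_ord.
have gS m (lt_md : (m < d)%N) : g m.+1 = gs_step (g m) (row (Ordinal lt_md) B).
  rewrite /g (take_nth 0) ?szs // -cats1 foldl_cat /=; congr gs_step.
  rewrite (nth_map (Ordinal lt_md)) -?cardE ?card_ord //.
  by congr row; apply: val_inj; rewrite /= nth_enum_ord.
have szg m : (m <= d)%N -> size (g m) = m.
  elim: m => [|m IH] le_md; first by rewrite /g take0.
  by rewrite gS size_rcons IH // ltnW.
have nthg m k : (k <= d)%N -> (m < k)%N -> nth 0 (g k) m = nth 0 (g m.+1) m.
  elim: k => // k IH le_kd; rewrite ltnS leq_eqVlt => /predU1P[-> //|lt_mk].
  by rewrite (gS _ le_kd) nth_rcons szg ?lt_mk ?IH // ltnW.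
have rowE (j : 'I_d) : row j (gram_schmidt B) = nth 0 (g d) j.
  by rewrite rowK /g take_oversize ?szs.
rewrite {1}rowE nthg // (gS _ (ltn_ord i)) nth_rcons szg ?ltnn ?eqxx 1?ltnW //.
have -> : Ordinal (ltn_ord i) = i by apply: val_inj.
congr (_ - _); rewrite (big_nth 0) szg 1?ltnW // big_mkord.
rewrite (big_ord_widen d
  (fun k => proj_coef (row i B) (nth 0 (g i) k) *: nth 0 (g i) k)) 1?ltnW //.
apply: eq_bigr => j lt_ji.
by rewrite rowE [in LHS]nthg 1?[in RHS]nthg // ltnW.
Qed.

Definition proj_orth (R : realType) (n : nat) (u v : 'rV[R]_n) : 'rV[R]_n :=
  v - proj_coef v u *: u.

Definition in_lattice (R : realType) (d n : nat) (B : 'M[R]_(d, n))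
    (v : 'rV[R]_n) : Prop :=
  exists z : 'rV[int]_d, v = map_mx intr z *m B.

Definition shortest_nonzero (R : realType) (d n : nat) (B : 'M[R]_(d, n))
    (v : 'rV[R]_n) : Prop :=
  [/\ in_lattice B v, v != 0 &
      forall w, in_lattice B w -> w != 0 -> enorm v <= enorm w].

(* The rows are b_2(2), ..., b_d(2), the projections of b_2, ..., b_d
   orthogonally to b_1. *)
Definition proj_tail (R : realType) (d n : nat) (B : 'M[R]_(d.+1, n)) :
    'M[R]_(d, n) :=
  \matrix_(i < d) proj_orth (row ord0 B) (row (lift ord0 i) B).

(* The guard 0 < d' expresses that a one-vector basis is always reduced. *)
Fixpoint hkz_cond (R : realType) (n d : nat) : 'M[R]_(d, n) -> Prop :=
  match d with
  | 0 => fun _ => True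
  | d'.+1 => fun B =>
      ((0 < d')%N -> shortest_nonzero B (row ord0 B)) /\ hkz_cond (proj_tail B)
  end.

Definition hkz_reduced (R : realType) (d n : nat) (B : 'M[R]_(d, n)) : Prop :=
  row_free B /\ hkz_cond B.

(* Main.v *)
Require Import Defs.
From HB Require Import structures.
From mathcomp Require Import all_boot all_order all_algebra.
From mathcomp Require Import reals sequences exp trigo.
From mathcomp Require Import all_classical all_reals all_analysis.
From mathcomp Require Import measurable_realfun ring zify.

Set Implicit Arguments.
Unset Strict Implicit.
Unset Printing Implicit Defensive.

Import Order.TTheory GRing.Theory Num.Theory.
Local Open Scope ring_scope.

(* The basis is lower triangular with rows [b_q = sum_k f(k) mu_(q,k) e_k], and
   the rows are chosen one after the other. Once the rows before [q] are chosen,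
   a vector of length less than [f(p)] in the lattice of [b_p(p), ..., b_q(p)]
   must have a nonzero coefficient [m] on [b_q], and [m < f(p) / f(q)] after a
   change of sign. If the entries [mu_(q,k)] are drawn uniformly modulo 1, the
   expected number of such vectors is the volume of a ball divided by
   [f(p) ... f(q-1)]; bounding the indicator of the ball by a Gaussian yields the
   [p]-th term of the hypothesis. As the terms sum up to less than 1, some row
   leaves no such vector. To avoid integrating over the entries, they are drawn
   from [{0, 1/N, ..., (N-1)/N}] for a large [N] prime to all the relevant [m],
   so that only the one-variable Gaussian integral is needed. *)

(** * Gaussian sums over shifted integers and over grids *)

Lemma le_of_eq (disp : Order.disp_t) (T : porderType disp) (x y : T) :
  x = y -> (x <= y)%O.
Proof. by move=> ->. Qed.

(** A right-endpoint Riemann sum of step [h]: as the Gaussian decreases on the nonnegative reals,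
    each term is at most the integral over its own interval. *)
Lemma gauss_sum_le (R : realType) (h : R) (J : nat) : 0 < h ->
  \sum_(j < J) h * expR (- (h * j.+1%:R) ^+ 2) <= Num.sqrt pi / 2.
Proof.
move=> h0; rewrite -lee_fin -integral0y_gauss.
have mg (A : set R) : measurable A ->
    measurable_fun A (EFin \o @gauss_fun R).
  move=> mA; apply/measurable_EFinP/measurable_funTS; exact: measurable_gauss_fun.
have g0 (x : R) : (0 <= (gauss_fun x)%:E)%E by rewrite lee_fin gauss_fun_ge0.
suff H : ((\sum_(j < J) h * expR (- (h * j.+1%:R) ^+ 2))%:E <=
    \int[lebesgue_measure]_(x in `[0%R, (h * J%:R)%R[) (gauss_fun x)%:E)%E.
  apply: (le_trans H); apply: ge0_subset_integral => //; first exact: mg.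
  by move=> x /=; rewrite !in_itv /= => /andP[-> _].
elim: J => [|J IH]; first by rewrite big_ord0 integral_ge0.
rewrite big_ord_recr /= EFinD.
have le1 : h * J%:R <= h * J.+1%:R by rewrite ler_pM2l // ler_nat.
have h1 : 0 <= h * J%:R by rewrite mulr_ge0 // ltW.
rewrite (@itv_bndbnd_setU _ _ _ (BLeft (h * J%:R))) ?bnd_simp //.
rewrite ge0_integral_setU //=; last 2 first.
- by apply: mg; apply: measurableU.
- apply/disj_set2P; rewrite -subset0 => x /= []; rewrite !in_itv /=.
  by move=> /andP[_ /lt_le_trans H] /andP[/H]; rewrite ltxx.
apply: leeD => //.
rewrite [leLHS](_ : _ = \int[lebesgue_measure]_(x in
    `[(h * J%:R)%R, (h * J.+1%:R)%R[) cst (expR (- (h * J.+1%:R) ^+ 2))%:E x)%E.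
  apply: ge0_le_integral => //; [by move=> *; rewrite lee_fin expR_ge0|exact: mg|].
  move=> x /=; rewrite in_itv /= => /andP[x1 x2].
  rewrite lee_fin /gauss_fun ler_expR lerN2 lerXn2r ?nnegrE ?(ltW x2) //.
    by apply: le_trans x1; rewrite mulr_ge0 // ltW.
  by rewrite mulr_ge0 // ltW.
rewrite integral_cst //= lebesgue_measure_itv /= lte_fin ltr_pM2l // ltr_nat ltnSn.
by rewrite -EFinB -EFinM -mulrBr -natrB // subSnn mulr1 mulrC.
Qed.

(** By injectivity this is a subsum over an initial segment of the naturals; the value 0 contributes
    at most [h], the others a Riemann sum. *)
Lemma sum_exp_inj_nat (R : realType) (I : finType) (P : pred I) (g : I -> nat)
    (h : R) : 0 < h -> {in P &, injective g} ->
  \sum_(i | P i) h * expR (- (h * (g i)%:R) ^+ 2) <= h + Num.sqrt pi / 2.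
Proof.
move=> h0 ginj.
pose G n := h * expR (- (h * n%:R) ^+ 2).
have G0 n : 0 <= G n by rewrite mulr_ge0 ?expR_ge0 // ltW.
pose M := (\max_(i | P i) g i).+1.
have gM i : P i -> (g i < M)%N by move=> Pi; rewrite ltnS leq_bigmax_cond.
have -> : \sum_(i | P i) h * expR (- (h * (g i)%:R) ^+ 2) =
   \sum_(n <- [seq g i | i <- enum P]) G n by rewrite big_map big_enum.
apply: (@le_trans _ _ (\sum_(n < M) G n)); last first.
  rewrite big_ord_recl /G mulr0 expr0n oppr0 expR0 mulr1 lerD2l.
  by apply: gauss_sum_le.
rewrite -(big_mkord xpredT G).
have U : uniq [seq g i | i <- enum P].
  rewrite map_inj_in_uniq ?enum_uniq // => i j.
  by rewrite !mem_enum; apply: ginj.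
rewrite [leRHS](bigID (mem [seq g i | i <- enum P])) /=.
rewrite -[leLHS]addr0; apply: lerD; last by apply: sumr_ge0.
rewrite -[leRHS]big_filter; apply: le_of_eq.
apply: perm_big; apply: uniq_perm => //; first by rewrite filter_uniq ?iota_uniq.
move=> n; rewrite mem_filter mem_index_iota /=; case: (boolP (n \in _)) => //=.
by case/mapP => i; rewrite mem_enum => Pi ->; rewrite gM.
Qed.

(* Split the shift as [c = h * (c' + theta)] with [c'] integer, [0 <= theta < 1];
   a point [h * (n + theta)] has absolute value at least [h * n] if [0 <= n] and
   at least [h * (- n - 1)] otherwise. *)
Lemma sum_exp_inj_int (R : realType) (I : finType) (g : I -> int) (h c : R) :
  0 < h -> injective g ->
  \sum_i h * expR (- (c + h * (g i)%:~R) ^+ 2) <= 2 * h + Num.sqrt pi.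
Proof.
move=> h0 ginj.
pose c' := Num.floor (c / h); pose th := c / h - c'%:~R.
have th0 : 0 <= th by rewrite subr_ge0 floor_le.
have th1 : th < 1 by rewrite ltrBlDl; have := floorD1_gt (c / h); rewrite rmorphD.
pose J i := g i + c'.
have cE i : c + h * (g i)%:~R = h * ((J i)%:~R + th).
  by rewrite /J /th rmorphD /=; field; rewrite gt_eqF.
rewrite (bigID (fun i => 0 <= J i)) /=.
rewrite (_ : 2 * h + Num.sqrt pi = (h + Num.sqrt pi / 2) + (h + Num.sqrt pi / 2));
  last by field.
have sq (x : R) (n : nat) : n%:R <= `|x| ->
    h * expR (- (h * x) ^+ 2) <= h * expR (- (h * n%:R) ^+ 2).
  move=> nx; rewrite ler_pM2l // ler_expR lerN2 !exprMn ler_pM2l ?exprn_gt0 //.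
  by rewrite -[x ^+ 2]real_normK ?num_real // lerXn2r // nnegrE.
apply: lerD.
  apply: le_trans (@sum_exp_inj_nat R I (fun i => 0 <= J i) (fun i => `|J i|%N) h h0 _).
    apply: ler_sum => i Ji; rewrite cE; apply: sq.
    rewrite natr_absz [`|J i|]ger0_norm //; apply: le_trans (ler_norm _).
    by rewrite lerDl.
  move=> i j /= Ji Jj E; apply: ginj; move: Ji Jj E; rewrite !unfold_in /J; lia.
apply: le_trans (@sum_exp_inj_nat R I (fun i => ~~ (0 <= J i))
  (fun i => `|- J i - 1|%N) h h0 _).
  apply: ler_sum => i Ji; rewrite cE; apply: sq.
  have Ji' : 0 <= - J i - 1 by lia.
  rewrite natr_absz ger0_norm // -normrN; apply: le_trans (ler_norm _).
  by rewrite rmorphB rmorphN /= opprD lerD2l lerN2 ltW.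
move=> i j /= Ji Jj E; apply: ginj; move: Ji Jj E; rewrite !unfold_in /J; lia.
Qed.

(** The numerators [N * xi + m * a] are distinct integers because [m] is invertible modulo [N], so
    the points lie on one shifted grid of step [s / N]. The average over [a] is thus at most the
    Gaussian integral plus [2 / N]. *)
Lemma grid_sum_le (R : realType) (I : finType) (xi : I -> int) (N m : nat)
    (s c : R) : (0 < N)%N -> coprime N m -> injective xi -> 0 < s ->
  \sum_(z : I * 'I_N)
    expR (- (s * ((xi z.1)%:~R + c + m%:R * (z.2%:R / N%:R))) ^+ 2) <=
  N%:R * (Num.sqrt pi / s + 2 / N%:R).
Proof.
move=> N0 cop xiI s0; have NR : 0 < N%:R :> R by rewrite ltr0n.
pose g (z : I * 'I_N) : int := N%:Z * xi z.1 + (m * z.2)%N%:Z.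
have h0 : 0 < s / N%:R by rewrite divr_gt0.
have ginj : injective g.
  move=> [x a] [y b] E.
  have : (N%:Z %| m%:Z * (a%:Z - b%:Z))%Z.
    by apply/dvdzP; exists (xi y - xi x); move: E; rewrite /g /= !PoszM; lia.
  rewrite Gauss_dvdzr // => /dvdzP[k Ek].
  have [ltaN ltbN] := (ltn_ord a, ltn_ord b).
  have k0 : k = 0 by nia.
  have ab : a = b by apply: val_inj; rewrite /=; lia.
  congr pair => //; apply: xiI; move: E; rewrite /g /= ab; nia.
have := sum_exp_inj_int (s * c) h0 ginj.
rewrite -mulr_sumr -ler_pdivlMl //.
rewrite [X in _ <= X -> _](_ : _ = N%:R * (Num.sqrt pi / s + 2 / N%:R)); last first.
  by field; rewrite !gt_eqF.
apply: le_trans; apply: le_of_eq.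
apply: eq_bigr => -[x a] _; congr (expR (- (_ ^+ 2))).
rewrite /g /= rmorphD !rmorphM /= -!pmulrn ?natrM.
by field; rewrite gt_eqF.
Qed.

(** * Averaging over a finite grid *)

Lemma sum_inj_le (R : realDomainType) (I J : finType) (f : I -> J) (F : J -> R) :
  injective f -> (forall j, 0 <= F j) -> \sum_i F (f i) <= \sum_j F j.
Proof.
move=> finj F0; rewrite (eq_bigl (fun i => i \in setT)) => [|i]; last by rewrite in_setT.
rewrite -(big_imset _ (in2W finj)) /= [leRHS](bigID (mem (f @: setT))) /=.
by rewrite lerDl sumr_ge0.
Qed.

Definition upd (q : nat) (Z : Type) (z : {ffun 'I_q -> Z}) (k : 'I_q) (y : Z) :
  {ffun 'I_q -> Z} := [ffun l => if l == k then y else z l].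

(** Swapping [y] with [z k] is an involution on the pairs [(z, y)]; reindexing by it turns
    [upd z k y] into [z]. *)
Lemma sum_upd (R : comNzRingType) (Z : finType) (q : nat) (k : 'I_q)
    (h : {ffun 'I_q -> Z} -> R) :
  \sum_z \sum_y h (upd z k y) = #|Z|%:R * \sum_z h z.
Proof.
rewrite pair_big /=.
rewrite (reindex_inj (h := fun u => (upd u.1 k u.2, u.1 k))) /=; last first.
  apply: (can_inj (g := fun u => (upd u.1 k u.2, u.1 k))) => -[z y] /=.
  congr pair; last by rewrite ffunE eqxx.
  by apply/ffunP => l; rewrite !ffunE; case: eqP => [->|].
transitivity (\sum_(u : {ffun 'I_q -> Z} * Z) h u.1).
  apply: eq_bigr => -[z y] _ /=; congr h.
  by apply/ffunP => l; rewrite !ffunE; case: eqP => [->|].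
rewrite -(pair_big xpredT xpredT (fun z _ => h z)) /= mulr_sumr.
by apply: eq_bigr => z _; rewrite sumr_const mulr_natl.
Qed.

(** The coordinates are summed out in increasing order: at coordinate [k], the factors before [k]
    are already constants and those after [k] do not involve it. *)
Lemma nested_sum_le (R : realFieldType) (Z : finType) (q : nat)
    (G : 'I_q -> {ffun 'I_q -> Z} -> R) (C : 'I_q -> R) :
  (0 < #|Z|)%N ->
  (forall k z, 0 <= G k z) ->
  (forall (k : 'I_q) (z z' : {ffun 'I_q -> Z}),
     (forall l : 'I_q, (k <= l)%N -> z l = z' l) -> G k z = G k z') ->
  (forall k z, \sum_y G k (upd z k y) <= C k) ->
  \sum_z \prod_k G k z <= \prod_k C k.
Proof.
move=> Z0 G0 Gdep GC; have ZR : 0 < #|Z|%:R :> R by rewrite ltr0n.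
have C0 k : 0 <= C k.
  case/card_gt0P: Z0 => y _; apply: le_trans (GC k [ffun=> y]).
  by apply: sumr_ge0 => *; apply: G0.
(* The first [j] factors are replaced with averaged bounds: [H 0] is the sum to estimate and [H q]
   has a constant summand. *)
pose g j (k : 'I_q) z := if (k < j)%N then C k / #|Z|%:R else G k z.
have g0 j k z : 0 <= g j k z by rewrite /g; case: ifP => // _; apply: divr_ge0.
pose H j := \sum_z \prod_k g j k z.
have HS (k : 'I_q) : H k <= H k.+1.
  rewrite -(ler_pM2l ZR) -(sum_upd k) mulr_sumr; apply: ler_sum => z _.
  have -> : \prod_l g k.+1 l z = C k / #|Z|%:R * \prod_(l | l != k) g k l z.
    rewrite (bigD1 k) //= {1}/g ltnSn; congr (_ * _); apply: eq_bigr => l lk.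
    by rewrite /g ltnS leq_eqVlt (inj_eq val_inj) (negPf lk).
  rewrite (eq_bigr (fun y => G k (upd z k y) * \prod_(l | l != k) g k l z)).
    rewrite -mulr_suml mulrA mulrCA divff ?gt_eqF // mulr1.
    by rewrite ler_wpM2r // prodr_ge0.
  move=> y _; rewrite (bigD1 k) //= {1}/g ltnn; congr (_ * _).
  apply: eq_bigr => l lk; rewrite /g; case: ltnP => // kl; apply: Gdep => i li.
  rewrite ffunE; case: eqP => // ik; move: lk; rewrite -(inj_eq val_inj) /=.
  by rewrite eqn_leq kl andbT -ik li.
have Hle j : (j <= q)%N -> H 0 <= H j.
  elim: j => // j IH jq; apply: le_trans (IH (ltnW jq)) _.
  exact: (HS (Ordinal jq)).
have -> : \sum_z \prod_k G k z = H 0 by [].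
apply: le_trans (Hle q (leqnn q)) _; rewrite /H.
rewrite [leLHS](eq_bigr (fun=> \prod_k (C k / #|Z|%:R))) => [|z _]; last first.
  by apply: eq_bigr => k _; rewrite /g ltn_ord.
rewrite sumr_const card_ffun card_ord -[leLHS]mulr_natl natrX.
rewrite big_split /= prodr_const card_ord mulrCA -exprMn mulfV ?gt_eqF //.
by rewrite expr1n mulr1.
Qed.

(** [2 / n] will be the grid error in each coordinate; by continuity at 0 a strict inequality
    survives it for large [n]. *)
Lemma horner_lt1_near0 (R : realType) (Q : {poly R}) : Q.[0] < 1 ->
  exists2 K : nat, (0 < K)%N & forall n, (K <= n)%N -> Q.[2 / n%:R] < 1.
Proof.
move=> Q0; have := @continuous_horner R Q 0.
move/cvgr_lt/(_ _ Q0) => -[e /= e0 He].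
exists (Num.trunc (2 / e)).+1 => // n Kn.
have n0 : 0 < n%:R :> R by rewrite ltr0n (leq_ltn_trans _ Kn).
have n1 : 2 / e < n%:R by apply: lt_le_trans (truncnS_gt _) _; rewrite ler_nat.
apply: He; rewrite /ball_ /= sub0r normrN ger0_norm ?divr_ge0 ?ltW //.
by rewrite ltr_pdivrMr // mulrC -ltr_pdivrMr.
Qed.

(* Every point of the grid of all [r] with entries in [{0, 1/N, ..., (N-1)/N}]
   which is not as required has a witness [x] of which the weight is at least 1,
   whereas the weights sum up to less than [N ^ q]. *)
Lemma exists_small_weights (R : realType) (q : nat)
    (c : 'I_q -> ('I_q -> int) -> R) (s : 'I_q -> 'I_q -> R) (E : 'I_q -> R)
    (M : 'I_q -> nat) :
  (forall (k : 'I_q) x y,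
     (forall l : 'I_q, (k < l)%N -> x l = y l) -> c k x = c k y) ->
  (forall p k, 0 < s p k) -> (forall p, 0 <= E p) ->
  \sum_p (M p)%:R * E p * \prod_(k < q | (p <= k)%N) (Num.sqrt pi / s p k) < 1 ->
  exists r : 'I_q -> R, forall p m x, (0 < m <= M p)%N ->
    E p * \prod_(k < q | (p <= k)%N)
      expR (- (s p k * ((x k)%:~R + c k x + m%:R * r k)) ^+ 2) < 1.
Proof.
move=> cdep s0 E0 small.
(* [Q] at [u] bounds the mean total weight when each coordinate has error [u]; at 0 it is the sum in
   the hypothesis. *)
pose Q : {poly R} := \sum_p ((M p)%:R * E p) *:
  \prod_(k < q | (p <= k)%N) ((Num.sqrt pi / s p k)%:P + 'X).
have QE u : Q.[u] = \sum_p (M p)%:R * E p *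
    \prod_(k < q | (p <= k)%N) (Num.sqrt pi / s p k + u).
  rewrite horner_sum; apply: eq_bigr => p _; rewrite hornerZ horner_prod.
  by congr (_ * _); apply: eq_bigr => k _; rewrite !hornerE.
have [K K0 QK] : exists2 K : nat, (0 < K)%N &
    forall n, (K <= n)%N -> Q.[2 / n%:R] < 1.
  apply: horner_lt1_near0; rewrite QE.
  by under eq_bigr do under eq_bigr do rewrite addr0.
(* Large enough for [QK], and congruent to 1 modulo every [m] with [0 < m <= M p], since such an [m]
   divides the factorial. *)
pose N := (K * (\max_p M p)`!).+1.
have N0 : (0 < N)%N by [].
have NR : 0 < N%:R :> R by rewrite ltr0n.
have copN p m : (0 < m <= M p)%N -> coprime N m.
  case/andP=> m0 mM; rewrite coprime_sym; apply: (@coprime_dvdl _ (K * (\max_p M p)`!)).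
    apply/dvdn_mull/dvdn_fact; rewrite m0 /=.
    exact: leq_trans mM (leq_bigmax_cond _ _).
  exact: coprimenS.
have {}QK : Q.[2 / N%:R] < 1.
  by apply: QK; apply: leqW; rewrite leq_pmulr ?fact_gt0.
apply: contrapT => Hno.
have bad (r : 'I_q -> R) : exists w : 'I_q * nat * ('I_q -> int),
    (0 < w.1.2 <= M w.1.1)%N /\ 1 <= E w.1.1 * \prod_(k < q | (w.1.1 <= k)%N)
      expR (- (s w.1.1 k * ((w.2 k)%:~R + c k w.2 + w.1.2%:R * r k)) ^+ 2).
  apply: contrapT => Hw; apply: Hno; exists r => p m x mM.
  by rewrite ltNge; apply/negP => le1; apply: Hw; exists (p, m, x).
pose rr (a : {ffun 'I_q -> 'I_N}) (k : 'I_q) : R := (a k)%:R / N%:R.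
have [w wP] := choice (fun a => bad (rr a)).
(* There are finitely many grid points, so one [X] bounds all coefficients of their witnesses; [I]
   encodes these shifted by [X]. *)
pose X := \max_a \max_k `|(w a).2 k|%N.
pose I : finType := 'I_(X.*2.+1).
pose xi (i : I) : int := i%:Z - X%:Z.
have xiI : injective xi by move=> i j /addIr [] /val_inj.
have Xlt : (X < X.*2.+1)%N by rewrite ltnS -addnn leq_addr.
pose i0 : I := Ordinal Xlt.
pose enc (v : int) : I := @inord X.*2 `|(v + X%:Z)%R|%N.
have wX a k : xi (enc ((w a).2 k)) = (w a).2 k.
  have le1 : (`|(w a).2 k| <= X)%N.
    by apply: leq_trans (leq_bigmax_cond a _); rewrite // (leq_bigmax_cond k).
  by rewrite /xi /enc /= inordK; lia.
(* Each coordinate carries a coefficient and a grid entry, summed out together. For [k < p] the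
   indicator in [G] pins the coefficient to [i0], so that no vector is counted once per value of an
   irrelevant coefficient. *)
pose Z : finType := (I * 'I_N)%type.
pose G (p : 'I_q) (m : nat) (k : 'I_q) (z : {ffun 'I_q -> Z}) : R :=
  if (p <= k)%N then
    expR (- (s p k * ((xi (z k).1)%:~R + c k (fun l => xi (z l).1)
                      + m%:R * ((z k).2%:R / N%:R))) ^+ 2)
  else ((z k).1 == i0)%:R.
have G0 p m k z : 0 <= G p m k z by rewrite /G; case: ifP; rewrite ?expR_ge0.
have Gsum (p : 'I_q) m : (0 < m <= M p)%N ->
    \sum_z \prod_k G p m k z <=
    N%:R ^+ q * \prod_(k < q | (p <= k)%N) (Num.sqrt pi / s p k + 2 / N%:R).
  move=> mM.
  have -> : N%:R ^+ q * \prod_(k < q | (p <= k)%N) (Num.sqrt pi / s p k + 2 / N%:R)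
    = \prod_(k < q) (N%:R * if (p <= k)%N then (Num.sqrt pi / s p k + 2 / N%:R) else 1).
    by rewrite big_split /= prodr_const card_ord -big_mkcond.
  apply: nested_sum_le => //.
  - by rewrite card_prod !card_ord.
  - move=> k z z' zz'; rewrite /G zz' //; case: ifP => // _.
    by rewrite (cdep k _ (fun l => xi (z' l).1)) // => l /ltnW kl; rewrite zz'.
  - move=> k z; rewrite /G; case: ifP => pk.
      have := grid_sum_le (c k (fun l => xi (z l).1)) N0 (copN _ _ mM) xiI (s0 p k).
      apply: le_trans; apply: le_of_eq.
      apply: eq_bigr => y _; rewrite ffunE eqxx.
      rewrite (cdep k _ (fun l => xi (z l).1)) // => l kl.
      by rewrite ffunE; case: eqP kl => // ->; rewrite ltnn.
    rewrite (eq_bigr (fun y : Z => (y.1 == i0)%:R * 1)) => [|y _]; last first.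
      by rewrite ffunE eqxx mulr1.
    rewrite -(pair_big xpredT xpredT (fun (x : I) (_ : 'I_N) => (x == i0)%:R * 1)) /=.
    rewrite (bigD1 i0) //= eqxx mulr1 sumr_const card_ord big1 ?addr0 ?mulr1 //.
    by move=> x /negPf->; rewrite big1 // => ? _; rewrite mul0r.
(* Each grid point is paired with its witness; keeping the grid point makes the map injective. *)
pose za a : {ffun 'I_q -> Z} :=
  [ffun k : 'I_q => (if ((w a).1.1 <= k)%N then enc ((w a).2 k) else i0, a k)].
have zaI : injective za.
  move=> a b /ffunP ab; apply/ffunP => k; have := ab k; rewrite !ffunE.
  by move=> /(congr1 snd).
pose Phi z : R := \sum_p \sum_(m < M p) E p * \prod_k G p m.+1 k z.
have Phi1 a : 1 <= Phi (za a).
  have [/andP[m0 mM] le1] := wP a; apply: le_trans le1 _.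
  rewrite /Phi [leRHS](bigD1 (w a).1.1) //=.
  have mlt : ((w a).1.2.-1 < M (w a).1.1)%N by rewrite prednK.
  rewrite [X in _ <= X + _](bigD1 (Ordinal mlt)) //= -addrA prednK //.
  rewrite -[leLHS]addr0; apply: lerD; last first.
    by apply: addr_ge0; do ?[apply: sumr_ge0 => *]; rewrite mulr_ge0 ?prodr_ge0.
  rewrite ler_wpM2l //; set p := (w a).1.1.
  rewrite [leRHS](bigID (fun k : 'I_q => (p <= k)%N)) /=.
  rewrite [X in _ <= _ * X]big1 ?mulr1 => [|k /negPf pk]; last first.
    by rewrite /G pk ffunE -/p pk eqxx.
  apply: le_of_eq; apply: eq_bigr => k pk.
  rewrite /G pk ffunE -/p pk wX /=.
  rewrite (cdep k (fun l => xi (za a l).1) (w a).2) // => l kl.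
  by rewrite ffunE -/p (leq_trans pk (ltnW kl)) wX.
have : N%:R ^+ q <= \sum_z Phi z.
  apply: (@le_trans _ _ (\sum_a Phi (za a))).
    apply: (@le_trans _ _ (\sum_(a : {ffun 'I_q -> 'I_N}) 1)); last exact: ler_sum.
    by rewrite sumr_const card_ffun !card_ord natrX.
  apply: sum_inj_le => // z.
  by do 2?[apply: sumr_ge0 => *]; rewrite mulr_ge0 ?prodr_ge0.
apply/negP; rewrite -ltNge /Phi exchange_big /=.
apply: (@le_lt_trans _ _ (N%:R ^+ q * Q.[2 / N%:R])); last first.
  by rewrite -[ltRHS]mulr1 ltr_pM2l ?exprn_gt0.
rewrite QE mulr_sumr; apply: ler_sum => p _; rewrite exchange_big /=.
apply: (@le_trans _ _ (\sum_(m < M p) E p * (N%:R ^+ q *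
   \prod_(k < q | (p <= k)%N) (Num.sqrt pi / s p k + 2 / N%:R)))).
  by apply: ler_sum => m _; rewrite -mulr_sumr ler_wpM2l // Gsum /=.
by rewrite sumr_const card_ord -mulr_natl; apply: le_of_eq; ring.
Qed.

(** * Gaussian weights and the choice of one row *)

Lemma powR_half_nat (R : realType) (y : R) (n : nat) : 0 <= y ->
  y `^ (n%:R / 2) = Num.sqrt y ^+ n.
Proof.
by move=> y0; rewrite mulrC powRrM powR12_sqrt // powR_mulrn ?sqrtr_ge0.
Qed.

Lemma card_ord_ge (q : nat) (p : 'I_q) : #|[pred k : 'I_q | (p <= k)%N]| = (q - p)%N.
Proof.
rewrite -sum1_card -(big_mkord (fun k => (p <= k)%N) (fun=> 1%N)).
have := @big_nat_widenl _ 0%N addn p 0 q xpredT (fun=> 1%N) (leq0n p).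
by rewrite /= => <-; rewrite sum_nat_const_nat muln1.
Qed.

(** The term of the hypothesis with [i = p] and [j = q]. The factor [k = q] stands apart: it bounds
    the number of multipliers [m] to exclude. *)
Definition weight_term (R : realType) (q : nat) (F : 'I_q -> R) (Fq : R) (p : 'I_q) : R :=
  (2 * pi * expR 1 / (q - p)%N%:R) `^ ((q - p)%N%:R / 2)
  * (Num.max (1 - (Fq / F p) ^+ 2) 0) `^ ((q - p)%N%:R / 2)
  * (\prod_(k < q | (p <= k)%N) (F p / F k) * (F p / Fq)).

(* With [n = q - p] and [r ^ 2 = F p ^ 2 - Fq ^ 2], the Gaussian weight is
   [exp (t (r ^ 2 - |u| ^ 2))]; [t = n / (2 r ^ 2)] minimises its total mass. *)
Lemma exists_row (R : realType) (q : nat) (F : 'I_q -> R) (Fq : R)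
    (c : 'I_q -> ('I_q -> int) -> R) :
  (forall k, 0 < F k) -> 0 < Fq ->
  (forall (k : 'I_q) x y,
     (forall l : 'I_q, (k < l)%N -> x l = y l) -> c k x = c k y) ->
  \sum_p weight_term F Fq p < 1 ->
  exists r : 'I_q -> R, forall p m x, (0 < m)%N ->
    F p ^+ 2 <= \sum_(k < q | (p <= k)%N)
      (F k * ((x k)%:~R + c k x + m%:R * r k)) ^+ 2 + (Fq * m%:R) ^+ 2.
Proof.
move=> F0 Fq0 cdep small.
pose n p := (q - p)%N; pose D p := F p ^+ 2 - Fq ^+ 2.
have n0 (p : 'I_q) : (0 < n p)%N by rewrite subn_gt0.
have D0 p : Fq < F p -> 0 < D p by move=> h; rewrite subr_gt0 ltr_pXn2r // nnegrE ltW.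
(* If [F p <= Fq], then [M p] is 0 and no multiplier is tested; the value 1 just keeps [t p]
   positive. *)
pose t p := if Fq < F p then (n p)%:R / (2 * D p) else 1.
have t0 (p : 'I_q) : 0 < t p.
  by rewrite /t; case: ifP => // h; rewrite divr_gt0 ?mulr_gt0 ?D0 // ltr0n.
pose s (p k : 'I_q) := Num.sqrt (t p) * F k.
have s0 p k : 0 < s p k by rewrite mulr_gt0 // sqrtr_gt0.
(* If [Fq < F p], this is [exp (t r ^ 2)], as [t p * D p] is [n p / 2]. *)
pose E (p : 'I_q) : R := expR ((n p)%:R / 2).
have E0 p : 0 <= E p by rewrite expR_ge0.
(* A vector shorter than [F p] has [m * Fq < F p], which bounds [m] and leaves no [m] when
   [F p <= Fq]. *)
pose M p := if Fq < F p then Num.trunc (F p / Fq) else 0%N.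
have small' : \sum_p (M p)%:R * E p *
    \prod_(k < q | (p <= k)%N) (Num.sqrt pi / s p k) < 1.
  apply: le_lt_trans small; apply: ler_sum => p _; rewrite /M; case: ifP => h; last first.
    by rewrite !mul0r !mulr_ge0 ?powR_ge0 ?prodr_ge0 ?invr_ge0 ?ltW // => k _;
      rewrite divr_ge0 ?ltW.
  have Dp := D0 _ h; have np0 : 0 < (n p)%:R :> R by rewrite ltr0n.
  have Fpq : (Num.trunc (F p / Fq))%:R <= F p / Fq.
    by rewrite truncn_le divr_ge0 // ltW.
  rewrite /weight_term mulrA (mulrC _ (F p / Fq)) -mulrA.
  rewrite (_ : E p * _ = (2 * pi * expR 1 / (q - p)%N%:R) `^ ((q - p)%N%:R / 2)
    * (Num.max (1 - (Fq / F p) ^+ 2) 0) `^ ((q - p)%N%:R / 2)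
    * \prod_(k < q | (p <= k)%N) (F p / F k)).
    rewrite ler_wpM2r // !mulr_ge0 ?powR_ge0 //.
    by apply: prodr_ge0 => k _; rewrite divr_ge0 ?ltW.
  have DFp : 1 - (Fq / F p) ^+ 2 = D p / F p ^+ 2 by rewrite /D; field; rewrite gt_eqF.
  rewrite DFp max_l ?divr_ge0 ?ltW ?exprn_gt0 //.
  (* Exponents [n p / 2] become [n p]-th powers of square roots, spread over the [n p] indices [k];
     the identity is then checked factor by factor. *)
  rewrite !powR_half_nat ?divr_ge0 ?mulr_ge0 ?pi_ge0 ?expR_ge0 ?sqr_ge0 1?ltW //.
  rewrite /E /n expRM_natl.
  rewrite -card_ord_ge -!prodr_const -!big_split /=; apply: eq_bigr => k _.
  rewrite card_ord_ge -/(n p).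
  have ea : expR 2^-1 ^+ 2 = expR 1 :> R by rewrite -expRM_natl divff.
  have -> : s p k = Num.sqrt (n p)%:R / (Num.sqrt 2 * Num.sqrt (D p)) * F k.
    by rewrite /s /t h [in LHS]sqrtrM ?ltW // sqrtrV ?mulr_ge0 ?(ltW Dp) // sqrtrM.
  have -> : Num.sqrt (2 * pi * expR 1 / (n p)%:R) =
      Num.sqrt 2 * Num.sqrt pi * expR 2^-1 / Num.sqrt (n p)%:R :> R.
    rewrite -ea sqrtrM ?mulr_ge0 ?pi_ge0 ?expR_ge0 // sqrtrV ?ltW //.
    rewrite sqrtrM ?mulr_ge0 ?pi_ge0 // sqrtr_sqr ger0_norm ?expR_ge0 //.
    by rewrite sqrtrM.
  have -> : Num.sqrt (D p / F p ^+ 2) = Num.sqrt (D p) / F p.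
    by rewrite sqrtrM ?(ltW Dp) // sqrtrV ?sqr_ge0 // sqrtr_sqr ger0_norm ?ltW.
  by field; rewrite !gt_eqF ?sqrtr_gt0.
have [r Hr] := exists_small_weights cdep s0 E0 small'.
exists r => p m x m0; rewrite leNgt; apply/negP => lt.
have S0 : 0 <= \sum_(k < q | (p <= k)%N) (F k * ((x k)%:~R + c k x + m%:R * r k)) ^+ 2.
  by apply: sumr_ge0 => k _; apply: sqr_ge0.
have lt1 : (Fq * m%:R) ^+ 2 < F p ^+ 2 by apply: le_lt_trans lt; rewrite lerDr.
have lt2 : Fq * m%:R < F p.
  by move: lt1; rewrite ltr_pXn2r ?nnegrE ?mulr_ge0 // ltW.
have h : Fq < F p.
  by apply: le_lt_trans lt2; rewrite ler_peMr ?ler1n ?(ltW Fq0).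
have mM : (0 < m <= M p)%N.
  rewrite m0 /M h truncn_ge_nat ?divr_ge0 ?ltW //.
  by rewrite ltr_pdivlMr // mulrC.
have := Hr p m x mM; apply/negP; rewrite -leNgt.
(* The weight is at least 1 exactly when the sum of squares is at most [D p], which follows from
   [lt] as [m] is at least 1. *)
rewrite -expR_sum -expRD -[leLHS]expR0 ler_expR sumrN subr_ge0.
rewrite (eq_bigr (fun k => t p * (F k * ((x k)%:~R + c k x + m%:R * r k)) ^+ 2));
  last first.
  by move=> k _; rewrite /s -mulrA exprMn sqr_sqrtr // ltW.
rewrite -mulr_sumr /t h.
have Dp := D0 _ h.
rewrite mulrAC ler_pdivrMr ?mulr_gt0 // [_ / 2 * _]mulrA divfK //.
rewrite ler_wpM2l // /D lerBrDr.
have le3 : Fq <= Fq * m%:R by rewrite ler_peMr ?ler1n ?(ltW Fq0).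
apply: le_trans (ltW lt); rewrite lerD2l lerXn2r // nnegrE ?(ltW Fq0) //.
exact: le_trans (ltW Fq0) le3.
Qed.

(** * Choice of all rows and the resulting bound on lattice vectors *)

(* The vectors of the lattice of b_p(p), ..., b_q(p) with a positive coefficient
   [x q] on b_q(p) have norm at least [F p]. *)
Definition good_row (R : realType) (F : nat -> R) (mu : nat -> nat -> R) (q : nat) :=
  forall (p : nat) (x : nat -> int), (p < q)%N -> 0 < x q ->
    F p ^+ 2 <= \sum_(k < q | (p <= k)%N)
      (F k * ((x k)%:~R + \sum_(l < q | (k < l)%N) (x l)%:~R * mu l k
              + (x q)%:~R * mu q k)) ^+ 2 + (F q * (x q)%:~R) ^+ 2.

(** Induction on the number of rows: [good_row] at [q] involves only rows up to [q], so appending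
    row [d] keeps the earlier ones good. Here [c] collects what the rows already chosen contribute
    to coordinate [k]. *)
Lemma exists_good_rows (R : realType) (F : nat -> R) (d : nat) :
  (forall k, 0 < F k) ->
  (forall q, (q < d)%N -> \sum_p weight_term (fun k : 'I_q => F k) (F q) p < 1) ->
  exists mu, forall q, (q < d)%N -> good_row F mu q.
Proof.
move=> F0; elim: d => [|d IH] small; first by exists (fun _ _ => 0).
have [|mu Hmu] := IH; first by move=> q qd; apply: small; apply: ltnW.
pose c (k : 'I_d) (x : 'I_d -> int) : R := \sum_(l < d | (k < l)%N) (x l)%:~R * mu l k.
have [//|//|||r Hr] := @exists_row R d (fun k => F k) (F d) c.
- by move=> k x y xy; apply: eq_bigr => l kl; rewrite xy.
- exact: small.
pose mu' l k := if l == d then oapp r 0 (insub k) else mu l k.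
exists mu' => q; rewrite ltnS => qd p x pq xq.
have mu'E (l k : nat) : (l < d)%N -> mu' l k = mu l k by rewrite /mu' => /ltn_eqF->.
have sumE : forall k : nat, \sum_(l < q | (k < l)%N) (x l)%:~R * mu' l k =
    \sum_(l < q | (k < l)%N) (x l)%:~R * mu l k.
  by move=> k; apply: eq_bigr => l _; rewrite mu'E // (leq_trans (ltn_ord l)).
under eq_bigr do rewrite sumE.
move: qd; rewrite leq_eqVlt => /predU1P[qd|qd]; last first.
  by under eq_bigr do rewrite mu'E //; apply: Hmu.
subst q; have := Hr (Ordinal pq) `|x d|%N (fun l => x l).
rewrite absz_gt0 gt_eqF // => /(_ isT).
have -> : `|x d|%N%:R = (x d)%:~R :> R by rewrite natr_absz ger0_norm // ltW.
by under [in X in _ -> X]eq_bigr do rewrite /mu' eqxx valK /=.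
Qed.

Definition unitri (R : realType) (mu : nat -> nat -> R) (l k : nat) : R :=
  if (k < l)%N then mu l k else (l == k)%:R.

(** Let [q] be the last index with a nonzero coefficient, positive up to a change of sign. If
    [p < q], row [q] is good; if [q = p], coordinate [p] alone is [F p] times a nonzero integer. *)
Lemma good_rows_bound (R : realType) (F : nat -> R) (mu : nat -> nat -> R)
    (n p : nat) (X : nat -> int) :
  (forall k, 0 < F k) -> (forall q, (q < n)%N -> good_row F mu q) ->
  (exists l : 'I_n, (p <= l)%N && (X l != 0)) ->
  F p ^+ 2 <= \sum_(k < n | (p <= k)%N)
    (F k * \sum_(l < n) (X l)%:~R * unitri mu l k) ^+ 2.
Proof.
move=> F0 good [l0 Xl0].
have [q] := @arg_maxnP _ l0 (fun l : 'I_n => (p <= l)%N && (X l != 0))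
  (fun l : 'I_n => l : nat) Xl0.
move=> /andP[pq Xq] qmax.
have X0 (l : 'I_n) : (q < l)%N -> X l = 0.
  move=> ql; apply/eqP; apply: contraLR ql => Xl; rewrite -leqNgt.
  by case: (leqP p l) => [pl|/ltnW lp]; [apply: qmax; rewrite pl|apply: leq_trans pq].
wlog Xq0 : X {l0 Xl0 qmax} X0 Xq / 0 < X q => [H|].
  have [?|] := ltP 0 (X q); first exact: H.
  rewrite le_eqVlt (negPf Xq) /= => Xq'.
  have H' := H (fun l => - X l); rewrite oppr_eq0 oppr_gt0 in H'.
  apply: le_trans (H' _ Xq Xq') _; first by move=> l /X0->; rewrite oppr0.
  apply: ler_sum => k _; rewrite -[leRHS]sqrrN -mulrN -sumrN.
  by under [in leRHS]eq_bigr do rewrite -mulNr -rmorphN.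
pose u (k : nat) : R := \sum_(l < n) (X l)%:~R * unitri mu l k.
have uE (k : nat) : u k = \sum_(l < q.+1) (X l)%:~R * unitri mu l k.
  rewrite /u [RHS](big_ord_widen n (fun l => (X l)%:~R * unitri mu l k)) //.
  rewrite [RHS]big_mkcond; apply: eq_bigr => l _; case: ifP => //.
  by move/negbT; rewrite -leqNgt => /X0->; rewrite mul0r.
have uq : u q = (X q)%:~R.
  rewrite uE big_ord_recr /= {2}/unitri ltnn eqxx mulr1 big1 ?add0r // => l _.
  by rewrite /unitri ltnNge ltnW //= ltn_eqF // mulr0.
have uk (k : 'I_q) : u k = (X k)%:~R + \sum_(l < q | (k < l)%N) (X l)%:~R * mu l k
              + (X q)%:~R * mu q k.
  rewrite uE big_ord_recr /= {2}/unitri ltn_ord; congr (_ + _).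
  rewrite (bigID (fun l : 'I_q => (k < l)%N)) /= addrC; congr (_ + _).
    rewrite (bigD1 k) ?ltnn //= {1}/unitri ltnn eqxx mulr1 big1 ?addr0 // => l.
    case/andP=> kl lk; rewrite /unitri (negPf kl) -(inj_eq val_inj) /= in lk *.
    by rewrite (negPf lk) mulr0.
  by apply: eq_bigr => l kl; rewrite /unitri kl.
apply: (@le_trans _ _ (\sum_(k < q.+1 | (p <= k)%N) (F k * u k) ^+ 2)); last first.
  rewrite (big_ord_widen_cond n (fun k => (p <= k)%N) (fun k => (F k * u k) ^+ 2)) //.
  rewrite [leRHS](bigID (fun k : 'I_n => (k < q.+1)%N)) /= lerDl.
  by apply: sumr_ge0 => k _; apply: sqr_ge0.
rewrite big_mkcond big_ord_recr /= pq -big_mkcond /= uq.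
under eq_bigr do rewrite uk.
move: pq; rewrite leq_eqVlt => /predU1P[->|pq]; last exact: good.
rewrite -[leLHS]add0r; apply: lerD; first by apply: sumr_ge0 => k _; apply: sqr_ge0.
rewrite exprMn ler_peMr ?sqr_ge0 // -rmorphXn /= ler1z; nia.
Qed.

(** * The triangular basis, its projections and its orthogonalisation *)

Lemma dotp_delta (R : realType) (n : nat) (v : 'rV[R]_n) (a : R) (j : 'I_n) :
  dotp v (a *: delta_mx 0 j) = v 0 j * a.
Proof.
rewrite /dotp (bigD1 j) //= big1 ?addr0 => [|k kj]; rewrite !mxE ?eqxx ?mulr1 //.
by rewrite (negPf kj) !mulr0.
Qed.

Lemma proj_coef_delta (R : realType) (n : nat) (v : 'rV[R]_n) (a : R) (j : 'I_n) :
  a != 0 -> proj_coef v (a *: delta_mx 0 j) = v 0 j / a.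
Proof.
by move=> a0; rewrite /proj_coef !dotp_delta !mxE !eqxx mulr1; field.
Qed.

Lemma enorm_delta (R : realType) (n : nat) (a : R) (j : 'I_n) :
  0 <= a -> enorm (a *: delta_mx 0 j) = a.
Proof.
by move=> a0; rewrite /enorm dotp_delta !mxE !eqxx mulr1 -expr2 sqrtr_sqr ger0_norm.
Qed.

(* The vectors b_(p+1)(p+1), ..., b_(p+m)(p+1), for the basis with Gram-Schmidt
   vectors [F k *: e_k] and coefficients [unitri mu]. *)
Definition tail_mx (R : realType) (F : nat -> R) (mu : nat -> nat -> R)
    (p m n : nat) : 'M[R]_(m, n) :=
  \matrix_(i < m, k < n) if (p <= k)%N then F k * unitri mu (p + i) k else 0.

Lemma row0_tail_mx (R : realType) (F : nat -> R) (mu : nat -> nat -> R)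
    (p m n : nat) (pn : (p < n)%N) :
  row ord0 (tail_mx F mu p m.+1 n) = F p *: delta_mx 0 (Ordinal pn).
Proof.
apply/rowP => k; rewrite !mxE addn0 /unitri.
rewrite [k == _]eq_sym -[Ordinal pn == k]/(p == k :> nat).
by case: (ltngtP p k) => [||->]; rewrite ?mulr0.
Qed.

(** The first row is a multiple of a unit vector, so projecting orthogonally to it merely erases
    coordinate [p]. *)
Lemma proj_tail_tail_mx (R : realType) (F : nat -> R) (mu : nat -> nat -> R)
    (p m n : nat) :
  (forall k, 0 < F k) -> (p < n)%N ->
  proj_tail (tail_mx F mu p m.+1 n) = tail_mx F mu p.+1 m n.
Proof.
move=> F0 pn; apply/matrixP => i k; rewrite mxE /proj_orth.
rewrite row0_tail_mx proj_coef_delta ?gt_eqF //.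
rewrite !mxE leqnn /= /bump /= addnS addSn.
rewrite [k == _]eq_sym -[Ordinal pn == k]/(p == k :> nat).
case: (ltngtP p k) => [||->]; rewrite ?mulr0 ?subr0 ?mulr1 //.
by rewrite divfK ?gt_eqF // subrr.
Qed.

Lemma shortest_tail_mx (R : realType) (F : nat -> R) (mu : nat -> nat -> R)
    (p m n : nat) :
  (forall k, 0 < F k) -> (p + m.+1 = n)%N ->
  (forall q, (q < n)%N -> good_row F mu q) ->
  shortest_nonzero (tail_mx F mu p m.+1 n) (row ord0 (tail_mx F mu p m.+1 n)).
Proof.
move=> F0 En good; have pn : (p < n)%N by rewrite -En addnS ltnS leq_addr.
split.
- exists (delta_mx 0 ord0); rewrite rowE; congr (_ *m _).
  by apply/matrixP => i j; rewrite !mxE; case: eqP; case: eqP.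
- rewrite row0_tail_mx; apply/eqP => /matrixP/(_ 0 (Ordinal pn)); rewrite !mxE !eqxx.
  by move/eqP; rewrite mulr1 gt_eqF.
move=> _ [z ->] w0; rewrite (row0_tail_mx _ _ _ pn) enorm_delta ?(ltW (F0 p)) //.
rewrite -[leLHS]ger0_norm ?(ltW (F0 p)) // -sqrtr_sqr ler_wsqrtr //.
(* The coefficient of row [i] moves to index [p + i], with zeros elsewhere, to match the numbering
   of the full basis. *)
pose X (l : nat) : int := if (p <= l)%N then oapp (z 0) 0 (insub (l - p)%N) else 0.
have Xi (i : 'I_m.+1) : X (p + i)%N = z 0 i.
  by rewrite /X leq_addr addKn valK.
subst n.
apply: le_trans (@good_rows_bound R F mu _ p X F0 good _) _.
  have [i zi] : exists i, z 0 i != 0.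
    apply/existsP; apply: contraNT w0; rewrite negb_exists => /forallP z0.
    apply/eqP; rewrite (_ : map_mx _ _ = 0) ?mul0mx //; apply/rowP => i.
    by rewrite !mxE; move/negPn/eqP: (z0 i) => ->.
  by exists (rshift p i); rewrite /= leq_addr Xi.
rewrite /dotp [leRHS](bigID (fun k : 'I_(p + m.+1) => (p <= k)%N)) /=.
apply: (@le_trans _ _ (\sum_(k < p + m.+1 | (p <= k)%N)
    (map_mx intr z *m tail_mx F mu p m.+1 (p + m.+1)) 0 k ^+ 2)); last first.
  by rewrite lerDl sumr_ge0 // => k _; rewrite -expr2 sqr_ge0.
apply: ler_sum => k pk; apply: le_of_eq.
congr (_ ^+ 2); rewrite big_split_ord /= big1 ?add0r => [|l _]; last first.
  by rewrite /X leqNgt ltn_ord /= mul0r.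
rewrite !mxE mulr_sumr; apply: eq_bigr => i _.
by rewrite Xi !mxE pk mulrCA.
Qed.

(** The start [p] varies because each projection in [hkz_cond] passes from [p] to [p.+1]. *)
Lemma hkz_cond_tail_mx (R : realType) (F : nat -> R) (mu : nat -> nat -> R)
    (p m n : nat) :
  (forall k, 0 < F k) -> (p + m = n)%N ->
  (forall q, (q < n)%N -> good_row F mu q) -> hkz_cond (tail_mx F mu p m n).
Proof.
move=> F0 En good; elim: m p En => // m IH p En.
have pn : (p < n)%N by rewrite -En addnS ltnS leq_addr.
split; first by move=> _; apply: shortest_tail_mx.
by rewrite proj_tail_tail_mx //; apply: IH; rewrite addSnnS.
Qed.

(** By strong induction the earlier Gram-Schmidt vectors lie along coordinate axes, so subtracting
    the projections removes the entries of row [i] left of the diagonal. *)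
Lemma row_gram_schmidt_tail_mx (R : realType) (F : nat -> R) (mu : nat -> nat -> R)
    (d : nat) (i : 'I_d) :
  (forall k, 0 < F k) ->
  row i (gram_schmidt (tail_mx F mu 0 d d)) = F i *: delta_mx 0 i.
Proof.
move=> F0; have [n] := ubnP (i : nat); elim: n i => // n IH i ltin.
rewrite gram_schmidtE.
under eq_bigr => j ji.
  rewrite IH ?(leq_trans ji) // proj_coef_delta ?gt_eqF //. over.
apply/rowP => k; rewrite !mxE summxE.
rewrite (eq_bigr (fun j => if k == j then F k * unitri mu i k else 0)) => [|j ji].
  rewrite -big_mkcondr /=; case: (ltngtP k i) => ki.
  - rewrite (big_pred1 k) => [|j]; last first.
      by rewrite /= eq_sym; case: eqP => [->|_]; rewrite ?ki ?andbF.
    by rewrite add0n subrr -(inj_eq val_inj) /= ltn_eqF // mulr0.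
  - rewrite big_pred0 ?subr0 => [|j].
      rewrite add0n /unitri ltnNge (ltnW ki) /= (ltn_eqF ki).
      by rewrite -[k == i]/(k == i :> nat) (gtn_eqF ki) !mulr0.
    by case: eqP => [<-|_]; rewrite ?andbF // ltnNge (ltnW ki).
  rewrite big_pred0 ?subr0 => [|j].
    by rewrite (val_inj ki) add0n /unitri ltnn !eqxx.
  by case: eqP => [<-|_]; rewrite ?andbF // ki ltnn.
rewrite !mxE /=; case: eqP => [->|_]; last by rewrite !mulr0.
by rewrite !mulr1 divfK ?gt_eqF // add0n.
Qed.

Lemma row_free_tail_mx (R : realType) (F : nat -> R) (mu : nat -> nat -> R)
    (d : nat) :
  (forall k, 0 < F k) -> row_free (tail_mx F mu 0 d d).
Proof.
move=> F0; rewrite row_free_unit unitmxE det_trig; last first.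
  apply/is_trig_mxP => i j ij; rewrite !mxE add0n /unitri ltnNge (ltnW ij) /=.
  by rewrite (ltn_eqF ij) mulr0.
rewrite unitfE; apply/prodf_neq0 => i _.
by rewrite !mxE add0n /unitri ltnn eqxx mulr1 gt_eqF.
Qed.

Theorem theorem1 (R : realType) (d : nat) (f : 'I_d -> R)
  (hd : (0 < d)%N)
  (hf : forall i : 'I_d, 0 < f i)
  (hsum : forall j : 'I_d,
    \sum_(i < d | (i < j)%N)
      (2 * pi * expR 1 / (j - i)%N%:R) `^ ((j - i)%N%:R / 2)
      * (Num.max (1 - (f j / f i) ^+ 2) 0) `^ ((j - i)%N%:R / 2)
      * (\prod_(k < d | (i <= k <= j)%N) (f i / f k)) < 1) :
  exists (n : nat) (B : 'M[R]_(d, n)),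
    hkz_reduced B /\
    forall i : 'I_d, enorm (row i (gram_schmidt B)) = f i.
Proof.
(* The default 1 keeps [F] positive on all naturals. *)
pose F k := oapp f 1 (insub k).
have FE (i : 'I_d) : F i = f i by rewrite /F valK.
have F0 k : 0 < F k by rewrite /F; case: insub.
have [mu good] : exists mu, forall q, (q < d)%N -> good_row F mu q.
  apply: exists_good_rows => // q qd; apply: le_lt_trans (hsum (Ordinal qd)).
  rewrite (big_ord_narrow (ltnW qd)) /=; apply: le_of_eq.
  apply: eq_bigr => p _; rewrite -!FE /= /weight_term; congr (_ * _).
  rewrite (eq_bigl (fun k : 'I_d => (p <= k)%N && (k < q.+1)%N)) //.
  rewrite (big_ord_narrow_cond qd).
  rewrite [RHS]big_mkcond big_ord_recr /= (ltnW (ltn_ord p)) -big_mkcond /= -FE /=.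
  by congr (_ * _); apply: eq_bigr => k _; rewrite -FE.
exists d, (tail_mx F mu 0 d d); split; first split.
- exact: row_free_tail_mx.
- exact: hkz_cond_tail_mx.
- by move=> i; rewrite row_gram_schmidt_tail_mx // enorm_delta ?FE // ltW.
Qed.
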